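(* Fix integers $b \ge 1$ and $c,\nu \ge 0$. The function $a \mapsto \gamma_a(b,c,\nu)$ defined on the set $\{a \in \mathbb{N} \mid a \ge 1\}$ is a polynomial in the variable $a$; that is, there exists $p\in\mathbb{Q}[x]$ such that $\gamma_a(b,c,\nu)=p(a)$ for all integers $a\ge 1$.
   Context: Agreement numbers: for integers $a,b\ge 1$ and $c,\nu\ge 0$, the agreement number $\gamma_a(b,c,\nu)$ is the integer defined via the recursion (where $0^0=1$) $$\gamma_a(b,c,\nu)=\sum_{s=0}^{c-1}\binom{b}{s}\gamma_{a-1}(b-s,c,\nu-s)+\sum_{s=c}^{\nu}\binom{b}{s}\binom{b-s}{\nu-s}(a-2)^{\nu-s}\quad\text{for } a\ge 2,\ b\ge c+1,\ \nu\ge c,$$ with initial conditions: $\gamma_a(b,c,\nu)=0$ if $a=1$ or $b<c$ or $\nu<c$ or $\nu>b$; and $\gamma_a(b,c,\nu)=a-1$ if $a\ge 2$ and $b=c=\nu$. Sums over empty index sets are $0$, and $\binom{x}{y}=0$ if $y>x\ge 0$.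
   Formalization: The case c = ν = 0 is excluded: there γ_1(b,0,0) = 0 while γ_a(b,0,0) = 1 for all a ≥ 2, so the function is not a polynomial on a ≥ 1. *)

(* Defs.v *)
From mathcomp Require Import all_boot all_order all_algebra.

Set Implicit Arguments.
Unset Strict Implicit.
Unset Printing Implicit Defensive.

Import Order.TTheory GRing.Theory Num.Theory.

Local Open Scope ring_scope.

(* [agreement a b c v] is gamma_a(b,c,v).  Only a >= 1 and b >= 1 are
   meaningful; the value at a = 0 is junk.  In the branch a = a2.+2 one has
   a - 1 = a1 and a - 2 = a2.  In the recursive branch c <= v <= b and c < b,
   so none of the natural-number subtractions truncates; the case v > b, where
   the initial condition and the recursion overlap, is covered by
   [agreement_rec]. *)
Fixpoint agreement (a b c v : nat) : int :=
  match a with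
  | (a2.+1 as a1).+1 =>
      if [|| b < c, v < c | b < v]%N then 0
      else if (b == c) && (c == v) then a1%:Z
      else \sum_(0 <= s < c) 'C(b, s)%:Z * agreement a1 (b - s) c (v - s)
         + \sum_(c <= s < v.+1)
             'C(b, s)%:Z * 'C(b - s, v - s)%:Z * a2%:Z ^+ (v - s)
  | _ => 0
  end.

Lemma agreement_init0 (a b c v : nat) :
  [|| a == 1, b < c, v < c | b < v]%N -> agreement a b c v = 0.
Proof. by case: a => [|[|a]] //= ->. Qed.

Lemma agreement_init1 (a b : nat) :
  (2 <= a)%N -> agreement a b b b = a%:Z - 1.
Proof.
case: a => [|[|a]] //= _; rewrite !ltnn eqxx /=.
by rewrite -[a.+2]addn1 PoszD addrK.
Qed.

Lemma agreement_rec (a b c v : nat) :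
  (2 <= a)%N -> (c < b)%N -> (c <= v)%N ->
  agreement a b c v =
    \sum_(0 <= s < c) 'C(b, s)%:Z * agreement a.-1 (b - s) c (v - s)
    + \sum_(c <= s < v.+1)
        'C(b, s)%:Z * 'C(b - s, v - s)%:Z * (a%:Z - 2) ^+ (v - s).
Proof.
case: a => [|[|a]] // _ lt_cb le_cv.
have -> : a.+2%:Z - 2 = a%:Z by rewrite -[a.+2]addn2 PoszD addrK.
have [lt_bv|le_vb] := ltnP b v; last first.
  rewrite [LHS]/= ![(_ < c)%N]ltnNge le_cv (ltnW lt_cb) ltnNge le_vb /=.
  by rewrite (gtn_eqF lt_cb).
rewrite agreement_init0; last by rewrite lt_bv !orbT.
rewrite big_nat big1 => [|s /andP[_ lt_sc]]; last first.
  rewrite agreement_init0 ?mulr0 // ltn_sub2r ?orbT //.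
  exact: ltn_trans (ltn_trans lt_sc lt_cb) lt_bv.
rewrite big1_seq ?addr0 // => s _.
have [lt_bs|le_sb] := ltnP b s; first by rewrite bin_small // !mul0r.
by rewrite ['C(b - s, _)]bin_small ?mulr0 ?mul0r // ltn_sub2r // (leq_ltn_trans le_sb).
Qed.

(* At c = v = 0 the initial condition at a = 1 gives 0 while the recursion
   gives (a - 2)^0 = 1 for every a >= 2, so the values there are not those of a
   polynomial on all a >= 1. *)
Lemma agreement00 (a b : nat) :
  (1 <= a)%N -> (1 <= b)%N -> agreement a b 0 0 = (2 <= a)%N%:Z.
Proof.
case: a => [|[|a]] // _ b_gt0.
rewrite agreement_rec // big_geq // big_nat1 /= !bin0.
by rewrite expr0.
Qed.

Lemma agreement00_not_poly (b : nat) : (1 <= b)%N ->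
  ~ exists p : {poly rat},
      forall a : nat, (1 <= a)%N -> (agreement a b 0 0)%:~R = p.[a%:R].
Proof.
move=> b_gt0 [p hp].
have p1 : p.[1] = 0 by rewrite -[1]/(1%:R) -hp // agreement00.
suff p_eq1 : p - 1 = 0.
  by move/eqP: p_eq1; rewrite subr_eq0 => /eqP p_eq1; move: p1; rewrite p_eq1 hornerC.
pose rs := [seq (i.+2)%:R : rat | i <- iota 0 (size (p - 1))].
apply: (@roots_geq_poly_eq0 _ _ rs).
- apply/allP => _ /mapP[i _ ->].
  by rewrite rootE hornerD hornerN hornerC -hp // agreement00 // subrr.
- by rewrite map_inj_uniq ?iota_uniq // => i j /eqP; rewrite eqr_nat => /eqP[].
- by rewrite size_map size_iota.
Qed.

(* Main.v *)
Require Import Defs.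
From mathcomp Require Import all_boot all_order all_algebra.

(** Fix [c >= 1] and put [g n = gamma_(n+1)(b,c,v)].  The [s = 0] term of the
    recursion is [g n] itself, so the recursion is a first-order difference
    equation: [g (n+1) - g n] is a combination of the sequences attached to the
    strictly smaller pairs [(b-s, v-s)], [0 < s < c], plus an explicit
    polynomial in [n]; for [b = c] the initial condition gives [g n = n] or
    [g n = 0] directly.  By induction on [b] the right-hand side is polynomial,
    and since [g 0 = 0] the sequence [g] is its indefinite sum, which is again
    polynomial by Faulhaber's theorem ([polyfun_psum]).  It is [g 0 = 0] that
    makes the polynomial valid from [a = 1] on.

    For [c = 0] there is no difference equation, because the first sum is empty:
    [g (n+1)] is explicitly [C(b,v) * (n+1)^v] by the binomial theorem, and this
    extends to [g 0 = 0] exactly when [v > 0]. *)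

Set Implicit Arguments.
Unset Strict Implicit.
Unset Printing Implicit Defensive.

Import Order.TTheory GRing.Theory Num.Theory.

Local Open Scope ring_scope.

Definition polyfun (f : nat -> rat) : Prop :=
  exists p : {poly rat}, forall n, f n = p.[n%:R].

Lemma eq_polyfun f g : f =1 g -> polyfun f -> polyfun g.
Proof. by move=> fg [p hp]; exists p => n; rewrite -fg. Qed.

Lemma polyfunC a : polyfun (fun=> a).
Proof. by exists a%:P => n; rewrite hornerC. Qed.

Lemma polyfunX m : polyfun (fun n => n%:R ^+ m).
Proof. by exists 'X^m => n; rewrite hornerXn. Qed.

Lemma polyfunD f g : polyfun f -> polyfun g -> polyfun (fun n => f n + g n).
Proof. by case=> p hp [q hq]; exists (p + q) => n; rewrite hornerD hp hq. Qed.

Lemma polyfunZ a f : polyfun f -> polyfun (fun n => a * f n).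
Proof. by case=> p hp; exists (a *: p) => n; rewrite hornerZ hp. Qed.

Lemma polyfun_sum (I : eqType) (r : seq I) (F : I -> nat -> rat) :
  {in r, forall i, polyfun (F i)} -> polyfun (fun n => \sum_(i <- r) F i n).
Proof.
elim: r => [|i r IHr] Fr.
  by apply: eq_polyfun (polyfunC 0) => n; rewrite big_nil.
apply: (@eq_polyfun (fun n => F i n + \sum_(j <- r) F j n)).
  by move=> n; rewrite big_cons.
apply: polyfunD; first by apply: Fr; rewrite mem_head.
by apply: IHr => j rj; apply: Fr; rewrite inE rj orbT.
Qed.

(** The binomial expansion of [(k+1)^(m+1) - k^(m+1)], telescoped over
    [k < n]. *)
Lemma power_sum_bin m n :
  n%:R ^+ m.+1
    = \sum_(j < m.+1) 'C(m.+1, j)%:R * \sum_(k < n) k%:R ^+ j :> rat.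
Proof.
elim: n => [|n IHn].
  by rewrite expr0n big1 // => j _; rewrite big_ord0 mulr0.
rewrite -[n.+1%:R]natr1 exprD1n big_ord_recr /= binn mulr1n IHn addrC -big_split.
by apply: eq_bigr => j _; rewrite big_ord_recr mulrDr /= -[_ ^+ _ *+ _]mulr_natl.
Qed.

(** Faulhaber for monomials: [power_sum_bin] gives [(m+1) * \sum_k k^m] in
    terms of [n^(m+1)] and the power sums of exponents below [m]. *)
Lemma polyfun_power_sum m : polyfun (fun n => \sum_(k < n) k%:R ^+ m).
Proof.
elim/ltn_ind: m => m IHm.
apply: (@eq_polyfun (fun n => m.+1%:R^-1 * (n%:R ^+ m.+1
   + \sum_(j < m) - 'C(m.+1, j)%:R * \sum_(k < n) k%:R ^+ j))).
  move=> n; apply: (canLR (mulKf _)); first by rewrite pnatr_eq0.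
  rewrite power_sum_bin big_ord_recr /= binSn addrAC -big_split big1 ?add0r //.
  by move=> j _; rewrite /= mulNr subrr.
apply/polyfunZ/polyfunD; first exact: polyfunX.
by apply: polyfun_sum => j _; apply/polyfunZ/IHm.
Qed.

Lemma polyfun_psum f : polyfun f -> polyfun (fun n => \sum_(k < n) f k).
Proof.
case=> p hp.
apply: (@eq_polyfun (fun n => \sum_(i < size p) p`_i * \sum_(k < n) k%:R ^+ i)).
  move=> n; under eq_bigr do rewrite mulr_sumr.
  by rewrite exchange_big; apply: eq_bigr => k _; rewrite hp horner_coef.
by apply: polyfun_sum => i _; apply/polyfunZ/polyfun_power_sum.
Qed.

Lemma polyfun_difference f d :
  f 0 = 0 -> (forall n, f n.+1 = f n + d n) -> polyfun d -> polyfun f.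
Proof.
move=> f0 fS /polyfun_psum; apply: eq_polyfun.
by elim=> [|n IHn]; rewrite ?big_ord0 // big_ord_recr /= IHn fS.
Qed.

(** The shift [a = n.+1] turns the initial condition at [a = 1] into a
    vanishing value at [n = 0], and [a - 2] in the recursion for [n.+2] into
    [n]. *)
Lemma polyfun_agreement c b v : (0 < c)%N ->
  polyfun (fun n => (agreement n.+1 b c v)%:~R).
Proof.
move=> c_gt0; elim/ltn_ind: b v => b IHb v.
have [triv|] := boolP [|| b < c, v < c | b < v]%N.
  apply: eq_polyfun (polyfunC 0) => n.
  by rewrite agreement_init0 // triv orbT.
rewrite !negb_or -!leqNgt => /and3P[le_cb le_cv le_vb].
case: (ltngtP c b) le_cb => // [lt_cb|eq_cb] _; last first.
  have -> : v = c by apply/eqP; rewrite eqn_leq le_cv eq_cb le_vb.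
  rewrite -eq_cb; apply: eq_polyfun (polyfunX 1) => -[|n].
    by rewrite agreement_init0.
  by rewrite agreement_init1 // -[n.+2]addn1 PoszD addrK.
apply: (polyfun_difference (d := fun n =>
   \sum_(1 <= s < c) 'C(b, s)%:R * (agreement n.+1 (b - s) c (v - s))%:~R
   + \sum_(c <= s < v.+1)
       'C(b, s)%:R * 'C(b - s, v - s)%:R * n%:R ^+ (v - s))).
- by rewrite agreement_init0.
- move=> n; rewrite agreement_rec //= -[n.+1.+1]addn2 PoszD addrK.
  rewrite big_ltn // bin0 mul1r !subn0 !rmorphD /= -addrA !rmorph_sum /=.
  congr (_ + (_ + _)); apply: eq_bigr => s _; first by rewrite rmorphM.
  by rewrite !rmorphM rmorphXn.
apply: polyfunD; apply: polyfun_sum => s; last first.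
  by move=> _; apply/polyfunZ/polyfunX.
rewrite mem_index_iota => /andP[s_gt0 _]; apply/polyfunZ/IHb.
by rewrite ltn_subrL s_gt0 (leq_ltn_trans _ lt_cb).
Qed.

(** Both sides count the chains of an [s]-subset inside a [v]-subset of a
    [b]-set. *)
Lemma mul_bin_sub b v s : (s <= v)%N -> (v <= b)%N ->
  ('C(b, s) * 'C(b - s, v - s) = 'C(b, v) * 'C(v, s))%N.
Proof.
move=> le_sv le_vb.
have := bin_fact (leq_sub2r s le_vb); rewrite -subnDA subnKC // => bs_fact.
apply/eqP; rewrite -(@eqn_pmul2r (s`! * ((v - s)`! * (b - v)`!))).
  2: by rewrite !muln_gt0 !fact_gt0.
rewrite mulnACA bs_fact -mulnA bin_fact ?(leq_trans le_sv) //.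
by rewrite [(s`! * _)%N]mulnA -mulnA [('C(v, s) * _)%N]mulnA !bin_fact.
Qed.

(** For [c = 0] the second sum of the recursion collapses by [mul_bin_sub] and the binomial theorem. *)
Lemma agreement_c0 a b v : (0 < b)%N -> (0 < v)%N ->
  agreement a.+1 b 0 v = 'C(b, v)%:Z * a%:Z ^+ v.
Proof.
move=> b_gt0 v_gt0; case: a => [|a].
  by rewrite agreement_init0 // expr0n -[v]prednK ?mulr0.
have [lt_bv|le_vb] := ltnP b v.
  by rewrite agreement_init0 ?lt_bv ?orbT // bin_small // mul0r.
rewrite agreement_rec // big_geq // add0r -[a.+2]addn2 PoszD addrK.
rewrite -[a.+1]addn1 PoszD exprDn mulr_sumr big_mkord; apply: eq_bigr => s _.
have le_sv : (s <= v)%N by rewrite -ltnS.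
by rewrite expr1n mulr1 -[_ ^+ _ *+ _]mulr_natl mulrA natz -!PoszM mul_bin_sub.
Qed.

Theorem theorem11p1 (b c v : nat) (hb : (1 <= b)%N)
    (hcv : ~ (c = 0%N /\ v = 0%N)) :
  exists p : {poly rat},
    forall a : nat, (1 <= a)%N -> (agreement a b c v)%:~R = p.[a%:R].
Proof.
suff [p hp] : polyfun (fun n => (agreement n.+1 b c v)%:~R).
  exists (p \Po ('X - 1%:P)) => -[//|n] _.
  by rewrite hp horner_comp hornerXsubC -natr1 addrK.
have [c_eq0|c_gt0] := posnP c; last exact: polyfun_agreement.
have v_gt0 : (0 < v)%N by rewrite lt0n; apply/eqP => v0; apply: hcv.
rewrite c_eq0; apply: eq_polyfun (polyfunZ 'C(b, v)%:R (polyfunX v)) => n.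
by rewrite agreement_c0 // rmorphM rmorphXn.
Qed.
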